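(* Let $X$ and $Y$ be finite nonempty sets and let $F: X \to 2^Y$ be a set-valued mapping. If $F$ admits a Hall partition, then $F$ satisfies the Hall condition.
   Context: A set-valued mapping $F: X \to 2^Y$ assigns to each $x \in X$ a (possibly empty) subset $F(x) \subset Y$. For $W \subset X$ put $F(W) = \bigcup_{x \in W} F(x)$; $\sharp$ denotes cardinality. $F$ satisfies the Hall condition if $\sharp F(W) \ge \sharp W$ for every $W \subset X$. For $W \subset X$, $F_W: X \setminus W \to 2^{Y}$ is the complement mapping $F_W(x) = F(x)\setminus F(W)$. These notions apply to any set-valued mapping $G$ on a finite set. A subset $W$ of the domain of $G$ is a critical set of $G$ if $W \neq \emptyset$ and $\sharp G(W) = \sharp W$; it is a non-reducible set of $G$ if $W \ne \emptyset$ and no proper subset of $W$ is a critical set of $G$. A tuple $(W_1, \ldots, W_m)$, $m \ge 1$, is a Hall partition of $F$ if $W_1, \ldots, W_m$ are nonempty pairwise disjoint sets with union $X$, and, writing $G_i = F_{W_1 \cup \cdots \cup W_{i-1}}$ (so $G_1 = F$): (i) $G_i(x) \neq \emptyset$ for all $x \in W_i$, $i = 1,\ldots,m$; (ii) $W_i$ is a non-reducible set of $G_i$ for $i=1,\ldots,m$; (iii) $W_i$ is a critical set of $G_i$ for $i = 1, \ldots, m-1$. *)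

(* Defs.v *)
From mathcomp Require Import all_boot.

Set Implicit Arguments.
Unset Strict Implicit.
Unset Printing Implicit Defensive.

Definition sv_image (X Y : finType) (F : X -> {set Y}) (W : {set X}) : {set Y} :=
  \bigcup_(x in W) F x.

Definition hall_condition (X Y : finType) (F : X -> {set Y}) : Prop :=
  forall W : {set X}, #|W| <= #|sv_image F W|.

(* F_W has domain X \ W. A set-valued mapping on a subset D of X is encoded as
   a total function on X together with D; its values outside D are irrelevant.
   The predicates below take D explicitly, and here D is ~: W. *)
Definition complement_map (X Y : finType) (F : X -> {set Y}) (W : {set X}) :
    X -> {set Y} :=
  fun x => F x :\: sv_image F W.

Definition critical_set (X Y : finType) (D : {set X}) (G : X -> {set Y})
    (W : {set X}) : Prop :=
  [/\ W \subset D, W != set0 & #|sv_image G W| = #|W|].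

Definition non_reducible_set (X Y : finType) (D : {set X}) (G : X -> {set Y})
    (W : {set X}) : Prop :=
  [/\ W \subset D, W != set0
    & forall V : {set X}, V \proper W -> ~ critical_set D G V].

Definition earlier (X : finType) (m : nat) (W : m.-tuple {set X}) (i : 'I_m) :
    {set X} :=
  \bigcup_(j < m | j < i) tnth W j.

(* Indices run from 0 to m - 1, so the last block is the one with i.+1 = m. *)
Definition hall_partition (X Y : finType) (F : X -> {set Y}) (m : nat)
    (W : m.-tuple {set X}) : Prop :=
  let D i := ~: earlier W i in
  let G i := complement_map F (earlier W i) in
  0 < m /\
  [/\ forall i, tnth W i != set0,
      forall i j, i != j -> [disjoint tnth W i & tnth W j]
    & \bigcup_(i < m) tnth W i = [set: X]] /\
  [/\ forall i x, x \in tnth W i -> G i x != set0,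
      forall i, non_reducible_set (D i) (G i) (tnth W i)
    & forall i : 'I_m, i.+1 < m -> critical_set (D i) (G i) (tnth W i)].

(* Main.v *)
Require Import Defs.
From mathcomp Require Import all_boot.

(** The Hall inequality holds inside each block: a minimal violating subset has
    at least two elements, and deleting one of them leaves a critical set.
    The sets [G_i (V :&: W_i)] are pairwise disjoint subsets of [F V], since the
    earlier ones lie in the part of [Y] that [G_i] removes, so summing the block
    inequalities gives the Hall condition for [V]. *)

Lemma sv_imageS (X Y : finType) (G : X -> {set Y}) (V W : {set X}) :
  V \subset W -> sv_image G V \subset sv_image G W.
Proof.
move=> sVW; apply/bigcupsP => x xV; apply: bigcup_sup.
exact: (subsetP sVW).
Qed.

Lemma non_reducible_hall (X Y : finType) (D : {set X}) (G : X -> {set Y})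
    (W : {set X}) :
  non_reducible_set D G W -> (forall x, x \in W -> G x != set0) ->
  forall V : {set X}, V \subset W -> #|V| <= #|sv_image G V|.
Proof.
(* Induction on a strict bound for [#|V|] plays the role of choosing a minimal violating subset. *)
move=> [sWD _ Wmin] Gn0 V; have [n] := ubnP #|V|.
elim: n V => // n IHn V leVn sVW.
have [->|[x xV]] := set_0Vmem V; first by rewrite cards0.
have cardV := cardsD1 x V; rewrite xV add1n in cardV.
have sV'V : V :\ x \subset V := subD1set V x.
have leGV : #|sv_image G (V :\ x)| <= #|sv_image G V|.
  exact/subset_leq_card/sv_imageS.
have leV' : #|V :\ x| <= #|sv_image G (V :\ x)|.
  by apply: IHn; [rewrite -cardV | apply: subset_trans sVW].
rewrite cardV ltnNge; apply/negP => leGV'.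
(* If [V] is the singleton of [x], the violation forces [G x] to be empty, against [Gn0]. *)
have [V'0|V'n0] := eqVneq (V :\ x) set0.
  move: leGV'; rewrite V'0 cards0 leqn0 cards_eq0 -subset0 => GV0.
  have := Gn0 x (subsetP sVW x xV); rewrite -subset0.
  by rewrite (subset_trans _ GV0) //; apply: bigcup_sup.
(* Otherwise [leV'], [leGV] and [leGV'] squeeze the image of [V :\ x] to exactly [#|V :\ x|]
   elements, so this proper subset of [W] is critical. *)
have prV' : V :\ x \proper W := proper_sub_trans (properD1 xV) sVW.
apply: (Wmin _ prV'); split=> //.
  exact: subset_trans (proper_sub prV') sWD.
by apply/eqP; rewrite eqn_leq leV' (leq_trans leGV).
Qed.

Lemma card_bigcup_disjoint (I T : finType) (A : I -> {set T}) :
  (forall i j, i != j -> [disjoint A i & A j]) ->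
  #|\bigcup_i A i| = \sum_i #|A i|.
Proof.
move=> dA; rewrite -sum1_card partition_disjoint_bigcup //.
by apply: eq_bigr => i _; rewrite sum1_card.
Qed.

Lemma disjoint_complement_map (X Y : finType) (F : X -> {set Y}) (m : nat)
    (W : m.-tuple {set X}) (V : 'I_m -> {set X}) :
  (forall i, V i \subset tnth W i) ->
  forall i j, i != j ->
    [disjoint sv_image (complement_map F (earlier W i)) (V i)
            & sv_image (complement_map F (earlier W j)) (V j)].
Proof.
move=> sVW.
have dlt (i j : 'I_m) : i < j ->
    [disjoint sv_image (complement_map F (earlier W i)) (V i)
            & sv_image (complement_map F (earlier W j)) (V j)].
  move=> ltij; apply/pred0P => y /=; apply/negP => /andP[].
  (* A common value [y] lies in [F x] for some [x] in block [i]. As [i < j], this [x] belongs to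
     [earlier W j], so [y] was removed from the [j]-th map. *)
  case/bigcupP=> x xVi /setDP[yFx _] /bigcupP[z _ /setDP[_ /negP]]; apply.
  apply/bigcupP; exists x => //; apply/bigcupP; exists i => //.
  exact: (subsetP (sVW i)).
move=> i j; rewrite neq_ltn => /orP[/dlt // | /dlt].
by rewrite disjoint_sym.
Qed.

Theorem theorem3p2 (X Y : finType) (hX : 0 < #|X|) (hY : 0 < #|Y|)
    (F : X -> {set Y}) :
  (exists (m : nat) (W : m.-tuple {set X}), hall_partition F W) ->
  hall_condition F.
Proof.
move=> [m [W [_ [[_ dW coverW] [Gn0 redW _]]]]] V.
have sVW i : V :&: tnth W i \subset tnth W i by exact: subsetIr.
pose GV i := sv_image (complement_map F (earlier W i)) (V :&: tnth W i).
have sGF : \bigcup_i GV i \subset sv_image F V.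
  apply/bigcupsP => i _; apply/bigcupsP => x /setIP[xV _].
  by apply: subset_trans (subsetDl _ _) _; apply: bigcup_sup.
apply: leq_trans (subset_leq_card sGF).
rewrite card_bigcup_disjoint; last exact: disjoint_complement_map.
(* The blocks cover [X], so their traces on [V] recover [V], and both sides become sums over the
   blocks. *)
have -> : #|V| = #|\bigcup_i (V :&: tnth W i)|.
  by rewrite -big_distrr /= coverW setIT.
rewrite card_bigcup_disjoint.
  by apply: leq_sum => i _; apply: (non_reducible_hall _ _ _ _ _ (redW i) (Gn0 i)).
move=> i j /dW dij.
exact: disjointWl (sVW i) (disjointWr (sVW j) dij).
Qed.
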